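(* Fix $f\in\mathcal H$. Then: 1. If $\int_{\mathbb R}x^{-2}\,d\sigma_{f-f^*}(x)=A<\infty$, then for all real $t>s$ $$\|P_{t,s}f-f^*\|_{\mathcal H}^2\le B(t-s)^{-2},\qquad\text{where one can take } B=4A.$$ 2. If for some constant $B>0$ the inequality $\|P_{t,s}f-f^*\|_{\mathcal H}^2\le B(t-s)^{-2}$ holds for all real $t>s$, then $$\int_{\mathbb R}x^{-2}\,d\sigma_{f-f^*}(x)\le A,\qquad\text{where one can take } A=8B.$$
   Context: $\mathcal H$ is a complex Hilbert space and $\{U^t\}_{t\in\mathbb R}$ is a strongly continuous group of unitary operators on $\mathcal H$. For $f\in\mathcal H$ and real $t>s$ put $P_{t,s}f=\frac1{t-s}\int_s^tU^\tau f\,d\tau$. $P$ is the orthogonal projection of $\mathcal H$ onto the subspace of vectors fixed by all $U^t$, and $f^*:=Pf$. By Stone's theorem $U^t=e^{it\mathbf B}$ with $\mathbf B$ self-adjoint; let $E$ be its spectral resolution, so that $(U^tf,g)_{\mathcal H}=\int_{\mathbb R}e^{it\lambda}\,d(E(\lambda)f,g)_{\mathcal H}$. For $h\in\mathcal H$, the spectral measure $\sigma_h$ is the finite Borel measure on $\mathbb R$ given by $\sigma_h(C)=\int_C d(E(\lambda)h,h)_{\mathcal H}$. Since $\sigma_{f-f^*}(\{0\})=0$, the value assigned to $x^{-2}$ at $x=0$ is immaterial. *)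

(* Defs.v *)
From HB Require Import structures.
From mathcomp Require Import all_boot all_order all_algebra.
From mathcomp Require Import complex.
From mathcomp Require Import all_classical all_reals all_analysis.
Set Implicit Arguments.
Unset Strict Implicit.
Unset Printing Implicit Defensive.
Import Order.TTheory GRing.Theory Num.Theory.
Import numFieldNormedType.Exports.
Local Open Scope classical_set_scope.
Local Open Scope ring_scope.
Local Open Scope complex_scope.

(* A complex Hilbert space: a complete normed space over R[i] whose norm comes
   from a scalar product, linear in its first argument. The norm of a normed
   module over R[i] is itself R[i]-valued (with nonnegative real values). *)
HB.mixin Record NormedModule_isHilbert (R : realType) H
    of CompleteNormedModule R[i] H := {
  hdot : {dot H for @Num.conj R[i]};
  hdot_norm : forall x : H, hdot x x = `|x| ^+ 2
}.

#[short(type=hilbertType)]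
HB.structure Definition Hilbert (R : realType) :=
  { H of NormedModule_isHilbert R H & CompleteNormedModule R[i] H }.

Section operators.
Context {R : realType} {H : hilbertType R}.
Implicit Types (T : H -> H) (U : R -> H -> H) (V : set H).

Definition unitary_operator T :=
  [/\ linear T, forall x y, hdot (T x) (T y) = hdot x y & range T = setT].

Definition strongly_continuous_unitary_group U :=
  [/\ forall t, unitary_operator (U t),
      U 0 = id,
      forall s t, U (s + t) = U s \o U t
    & forall f, continuous (fun t => U t f)].

Definition orthogonal_projection T :=
  [/\ linear T, forall x, T (T x) = T x
    & forall x y, hdot (T x) y = hdot x (T y)].

Definition orthogonal_projection_onto V T :=
  orthogonal_projection T /\ range T = V.

Definition fixed_space U : set H := [set f | forall t, U t f = f].

End operators.

Section riemann_integral.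
Context {R : realType} {V : normedModType R[i]}.
Implicit Types (F : R -> V) (a b : R).

(* [a :: s] lists the nodes of a partition of [a, b]; [xi] gives the tags. *)
Definition riemann_sum F a b (s : seq R) (xi : nat -> R) : V :=
  \sum_(i < size s) (nth b s i - nth b (a :: s) i)%:C *: F (xi i).

Definition is_riemann_integral F a b (v : V) :=
  forall e : R, 0 < e -> exists2 d : R, 0 < d &
    forall (s : seq R) (xi : nat -> R), itv_partition a b s ->
      (forall i, (i < size s)%N -> nth b s i - nth b (a :: s) i < d) ->
      (forall i, (i < size s)%N -> nth b (a :: s) i <= xi i <= nth b s i) ->
      `|riemann_sum F a b s xi - v| < e%:C.

(* Norm-convergent integral over [a, b], meant for [a < b]; 0 when it does
   not exist. *)
Definition riemann_integral F a b : V :=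
  xget 0 [set v | is_riemann_integral F a b v].

End riemann_integral.

Definition ergodic_average {R : realType} {H : hilbertType R}
    (U : R -> H -> H) (t s : R) (f : H) : H :=
  ((t - s)^-1)%:C *: riemann_integral (fun tau => U tau f) s t.

(* Resolution of the identity [E(lambda)], with the right-continuous
   normalization. *)
Record spectral_family (R : realType) (H : hilbertType R) := SpectralFamily {
  sf_fun :> R -> H -> H;
  sf_proj : forall l, orthogonal_projection (sf_fun l);
  sf_min : forall l m x, sf_fun l (sf_fun m x) = sf_fun (Num.min l m) x;
  sf_right_cont : forall l x, (fun m => sf_fun m x) @ l^'+ --> sf_fun l x;
  sf_Ny : forall x, (fun m => sf_fun m x) @ -oo%R --> (0 : H);
  sf_y : forall x, (fun m => sf_fun m x) @ +oo%R --> x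
}.

Section spectral_measure.
Context {R : realType} {H : hilbertType R}.
Variable E : spectral_family H.
Implicit Types (h f g : H).

(* The scalar product below is real, since [E l] is an orthogonal projection. *)
Definition spectral_distribution h (l : R) : R := complex.Re (hdot (E l h) h).

Lemma spectral_distributionB h l m : l <= m ->
  `|E m h - E l h| ^+ 2 =
    (spectral_distribution h m - spectral_distribution h l)%:C.
Proof.
move=> lm; rewrite -hdot_norm.
have [_ El_id El_sa] := sf_proj E l; have [_ Em_id Em_sa] := sf_proj E m.
have dE k : hdot (E k h) h = `|E k h| ^+ 2.
  have [_ Ek_id Ek_sa] := sf_proj E k.
  by rewrite -hdot_norm -Ek_sa Ek_id.
have qE k : hdot (E k h) h = (spectral_distribution h k)%:C.
  rewrite /spectral_distribution [RHS]complexRe dE.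
  apply/esym/Creal_ReP; rewrite realX//; exact: normr_real.
rewrite linearBr/= !linearBl/=.
rewrite -Em_sa Em_id -(Em_sa (E l h)) sf_min (min_r lm).
rewrite -!(El_sa _ h) El_id sf_min (min_l lm) !qE.
by rewrite subrr subr0 -rmorphB.
Qed.

Lemma spectral_distribution_nd h : nondecreasing (spectral_distribution h).
Proof.
move=> l m lm; rewrite -subr_ge0 -lecR -spectral_distributionB//.
by rewrite exprn_ge0.
Qed.

Lemma spectral_distribution_rc h : right_continuous (spectral_distribution h).
Proof.
move=> l; apply/(@cvgrPdist_lt R R) => e e0.
have /cvgrPdist_lt/(_ (Num.sqrt e)%:C) := @sf_right_cont _ _ E l h.
rewrite ltcR sqrtr_gt0 => /(_ e0) near_l.
near=> m.
have lm : l <= m by near: m; apply: nbhs_right_ge.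
rewrite distrC ger0_norm ?subr_ge0 ?spectral_distribution_nd//.
rewrite -ltcR -spectral_distributionB// -(sqr_sqrtr (ltW e0)) rmorphXn/=.
rewrite ltr_pXn2r ?nnegrE// ?lecR ?sqrtr_ge0// distrC.
by near: m.
Unshelve. all: by end_near. Qed.

HB.instance Definition _ h := @isCumulative.Build R _ R
  (spectral_distribution h) (@spectral_distribution_nd h)
  (@spectral_distribution_rc h).

Definition spectral_measure h := lebesgue_stieltjes_measure
  (spectral_distribution h : cumulative R R).
HB.instance Definition _ h := Measure.on (spectral_measure h).

Definition spectral_integral_diag (phi : R -> R[i]) h : R[i] :=
  (\int[spectral_measure h]_l complex.Re (phi l)) +i*
  (\int[spectral_measure h]_l complex.Im (phi l)).

(* The integral of [phi] against the complex measure [d(E(lambda) f, g)],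
   whose value on a Borel set [C] is, by polarization,
   [4^-1 * \sum_(k < 4) 'i ^+ k * spectral_measure (f + 'i ^+ k *: g) C]. *)
Definition spectral_integral (phi : R -> R[i]) f g : R[i] :=
  4^-1 * \sum_(k < 4) 'i ^+ k * spectral_integral_diag phi (f + 'i ^+ k *: g).

End spectral_measure.

(* [E] is the spectral resolution of the self-adjoint operator [B] such that
   [U t = exp (i t B)]. *)
Definition spectral_resolution_of {R : realType} {H : hilbertType R}
    (U : R -> H -> H) (E : spectral_family H) :=
  forall (t : R) (f g : H), hdot (U t f) g =
    spectral_integral E (fun l => cos (t * l) +i* sin (t * l)) f g.

(* Main.v *)
Require Import Defs.
From mathcomp Require Import all_boot all_order all_algebra.
From mathcomp Require Import complex.
From mathcomp Require Import all_classical all_reals all_analysis.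
From mathcomp Require Import measurable_realfun ring lra.
Import Order.TTheory GRing.Theory Num.Theory.
Import numFieldNormedType.Exports.
Set Implicit Arguments.
Unset Strict Implicit.
Unset Printing Implicit Defensive.
Local Open Scope classical_set_scope.
Local Open Scope ring_scope.
Local Open Scope complex_scope.

(** The two halves both come from one identity. Put g = f - P f. The map
    sending U^t h to the function x |-> e^(itx) extends to an isometry from the
    span of the orbit of h into L^2 of the spectral measure of h
    (hnorm_trig_vec), so the squared norm of the integral of U^t g over [s, t]
    is the integral against sigma_g of the function
      |(e^(itx) - e^(isx)) / (ix)|^2 = (2 - 2 cos ((t - s) x)) / x^2,
    read as (t - s)^2 at x = 0.
      This identity (ergodic_average_energy) is obtained by passing to the limit
    in Riemann sums; the same isometry shows that the Riemann sums are Cauchy,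
    hence that the vector-valued Riemann integral exists, because the Riemann
    sums of t |-> e^(itx) converge boundedly in x.

    For the first half, 2 - 2 cos is at most 4, which bounds the energy by
    4 x^-2 away from x = 0. The point 0 is null for sigma_g
    (spectral_measure_atom0): the jump of E at 0 applied to g is a vector fixed
    by all U^t, whereas g is orthogonal to the fixed vectors.

    For the second half, the hypothesis says that
    (2 - 2 cos (t x)) / x^2 has sigma_g-integral at most B for every t > 0.
    Averaging over more and more values of t makes the cosines cancel
    (mean_deficit_cvg), and the lemma of Fatou bounds the integral of 2 x^-2
    by B. *)

(** * Real-valued norm and scalar product *)

Section hilbert.
Context {R : realType} {H : hilbertType R}.
Implicit Types x y : H.

(** The norm and the scalar product of [H] live in [R[i]]; their real parts
    carry all that is needed and make order reasoning available. *)
Definition hnorm x : R := complex.Re `|x|.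
Definition rdot x y : R := complex.Re (hdot x y).

Lemma normE x : `|x| = (hnorm x)%:C.
Proof.
have := normr_ge0 x; rewrite /hnorm; case: `|x| => a b.
by rewrite lecE /= => /andP[/eqP -> _].
Qed.

Lemma hnorm_ge0 x : 0 <= hnorm x.
Proof. rewrite -lecR -normE; exact: normr_ge0. Qed.

Lemma hnormD x y : hnorm (x + y) <= hnorm x + hnorm y.
Proof. by rewrite -lecR rmorphD/= -!normE ler_normD. Qed.

Lemma rdotxx x : rdot x x = hnorm x ^+ 2.
Proof. by rewrite /rdot hdot_norm normE -rmorphXn. Qed.

Lemma rdotDl x y z : rdot (x + y) z = rdot x z + rdot y z.
Proof. by rewrite /rdot linearDl raddfD. Qed.

Lemma rdotZl (c : R) x y : rdot (c%:C *: x) y = c * rdot x y.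
Proof.
rewrite /rdot linearZl_LR/=; case: (hdot x y) => a b /=; ring.
Qed.

Lemma rdotC x y : rdot x y = rdot y x.
Proof.
rewrite /rdot hermC /= expr0 mul1r.
by case: (hdot y x).
Qed.

Lemma rdotNl x y : rdot (- x) y = - rdot x y.
Proof. by rewrite /rdot linearNl raddfN. Qed.

Lemma rdotNr x y : rdot x (- y) = - rdot x y.
Proof. by rewrite rdotC rdotNl rdotC. Qed.

Lemma rdotDr x y z : rdot z (x + y) = rdot z x + rdot z y.
Proof. by rewrite rdotC rdotDl !(rdotC z). Qed.

Lemma rdotZr (c : R) x y : rdot y (c%:C *: x) = c * rdot y x.
Proof. by rewrite rdotC rdotZl rdotC. Qed.

Lemma hnormZ (c : R) x : hnorm (c%:C *: x) = `|c| * hnorm x.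
Proof.
apply/eqP; rewrite -(eqrXn2 (n := 2))// ?hnorm_ge0 ?mulr_ge0 ?hnorm_ge0//.
by rewrite exprMn -!rdotxx rdotZl rdotZr real_normK ?num_real// mulrA.
Qed.

Lemma hnormN x : hnorm (- x) = hnorm x.
Proof. by rewrite /hnorm normrN. Qed.

Lemma hdistC x y : hnorm (x - y) = hnorm (y - x).
Proof. by rewrite -hnormN opprB. Qed.

Lemma hnorm_eq0 x : hnorm x = 0 -> x = 0.
Proof. by move=> x0; apply/eqP; rewrite -normr_eq0 normE x0. Qed.

Lemma hnormB_sqr x y :
  hnorm (x - y) ^+ 2 = hnorm x ^+ 2 + hnorm y ^+ 2 - 2 * rdot x y.
Proof.
rewrite -!rdotxx rdotDl !rdotDr !rdotNl !rdotNr (rdotC y x); ring.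
Qed.

Lemma cvg_hnorm {T} {F : set_system T} {FF : Filter F} (u : T -> H) x :
  u @ F --> x <-> forall e : R, 0 < e -> \forall t \near F, hnorm (u t - x) < e.
Proof.
split=> [/cvgrPdist_lt ux e e0|ux].
  have := ux e%:C; rewrite ltcR => /(_ e0); apply: filterS => t.
  by rewrite normE ltcR hdistC.
apply/cvgrPdist_lt => -[e e']; rewrite ltcE /= => /andP[/eqP-> e0].
by apply: filterS (ux _ e0) => t h; rewrite normE ltcR hdistC.
Qed.

Lemma hilbert_complete (u : nat -> H) :
  (forall e : R, 0 < e -> exists N, forall m n, (N <= m)%N -> (N <= n)%N ->
     hnorm (u m - u n) < e) ->
  exists x, u @ \oo --> x.
Proof.
move=> uC; suff : cvg (u @ \oo) by move=> h; exists (lim (u @ \oo)).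
apply/cauchy_cvgP/cauchy_exP => -[e e']; rewrite ltcE /= => /andP[/eqP-> e0].
have [N uN] := uC _ e0.
exists (u N); exists N => // n /= Nn.
by rewrite -ball_normE /ball_/= normE ltcR uN.
Qed.

Lemma cvg_hnorm_sqr (u : nat -> H) x :
  u @ \oo --> x -> hnorm (u n) ^+ 2 @[n --> \oo] --> hnorm x ^+ 2.
Proof.
move=> ux; suff h : hnorm (u n) @[n --> \oo] --> hnorm x.
  by rewrite expr2; under eq_fun do rewrite expr2; apply: cvgM.
apply/(@cvgrPdist_lt R R) => e e0.
move/cvg_hnorm: ux => /(_ _ e0); apply: filterS => n; apply: le_lt_trans.
rewrite ler_norml; apply/andP; split.
  by have := hnormD (u n - x) x; rewrite subrK; lra.
by have := hnormD (x - u n) (u n); rewrite subrK (hdistC (u n)); lra.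
Qed.

End hilbert.

(** * The spectral measure *)

Section spectral_measure.
Context {R : realType} {H : hilbertType R} (E : spectral_family H).
Implicit Types (h x y : H) (l m : R).

Let F := spectral_distribution E.

Lemma spectral_distributionE h l : F h l = hnorm (E l h) ^+ 2.
Proof.
have [_ El_id El_sa] := sf_proj E l.
by rewrite /F /spectral_distribution -rdotxx /rdot -El_sa El_id.
Qed.

Lemma spectral_measure_ocitv h l m : l <= m ->
  spectral_measure E h `]l, m] = (F h m - F h l)%:E.
Proof.
move=> lm; rewrite /spectral_measure /lebesgue_stieltjes_measure.
rewrite /measure_extension measurable_mu_extE/=; last exact: is_ocitv.
by rewrite wlength_itv_bnd.
Qed.

(** Continuity from below along the intervals ]-n, n], together with the
    limits of [E] at both infinities. *)
Lemma spectral_measureT h : spectral_measure E h setT = (hnorm h ^+ 2)%:E.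
Proof.
have FT : F h n%:R @[n --> \oo] --> hnorm h ^+ 2.
  under eq_fun do rewrite spectral_distributionE.
  apply: cvg_hnorm_sqr.
  exact: (cvg_comp _ _ (@cvgr_idn R) (@sf_y _ _ E h)).
have F0 : F h (- n%:R) @[n --> \oo] --> (0 : R).
  under eq_fun do rewrite spectral_distributionE.
  have -> : 0 = hnorm (0 : H) ^+ 2.
    by rewrite /hnorm normr0 expr0n.
  apply: cvg_hnorm_sqr.
  have Ny : (- n%:R : R) @[n --> \oo] --> -oo%R.
    apply/cvgNry; rewrite (_ : - _ = fun n => n%:R); first exact: cvgr_idn.
    by apply/funext => n; rewrite opprfctE opprK.
  exact: (cvg_comp _ _ Ny (@sf_Ny _ _ E h)).
rewrite -(bigcup_itvT false false).
pose I n : set R := `]- (n%:R), n%:R]%classic.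
have IE : (spectral_measure E h \o I) n @[n --> \oo] --> (hnorm h ^+ 2)%:E.
  have -> : spectral_measure E h \o I = (fun n => (F h n%:R - F h (- n%:R))%:E).
    by apply/funext => n; rewrite /= spectral_measure_ocitv// ge0_cp.
  apply: cvg_EFin; first by near=> n.
  by rewrite -[X in _ --> X]subr0; apply: cvgB.
have : (spectral_measure E h \o I) n @[n --> \oo] --> spectral_measure E h
  (\bigcup_n I n).
  apply: nondecreasing_cvg_mu; rewrite /I//; first exact: bigcup_measurable.
  by move=> *; apply/subsetPset/subset_itv; rewrite leBSide/= ?lerN2 ler_nat.
move=> /cvg_unique; exact.
Unshelve. all: end_near. Qed.

Lemma spectral_distributionZ (c : R[i]) h l :
  F (c *: h) l = (complex.Re c ^+ 2 + complex.Im c ^+ 2) * F h l.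
Proof.
have [El_lin _ _] := sf_proj E l.
rewrite /F /spectral_distribution.
have -> : E l (c *: h) = c *: E l h.
  have E0 : E l 0 = 0 by have := El_lin (-1) 0 0;
    rewrite scaler0 addr0 scaleN1r addNr.
  by have := El_lin c h 0; rewrite !addr0 E0 addr0.
rewrite linearZl_LR linearZr_LR/=.
by case: c (hdot _ _) => [a b] [x y] /=; ring.
Qed.

(** Both sides agree on half-open intervals, where they are increments of the
    quadratic form l |-> (E l h, h). *)
Lemma spectral_measureZ (c : R[i]) h (k : {nonneg R}) A :
    k%:num = complex.Re c ^+ 2 + complex.Im c ^+ 2 -> measurable A ->
  spectral_measure E (c *: h) A = mscale k (spectral_measure E h) A.
Proof.
move=> kE; apply: lebesgue_stieltjes_measure_unique => X [[l m] _ <-] /=.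
have [lm|ml] := leP l m;
  last by rewrite set_itv_ge ?measure0// bnd_simp -leNgt ltW.
have := spectral_measure_ocitv (c *: h) lm; rewrite /spectral_measure => ->.
rewrite /mscale/= spectral_measure_ocitv// -EFinM mulrBr kE.
by rewrite !spectral_distributionZ.
Qed.

(** At [f = g] every vector in the polarization formula is a multiple of the
    same vector; this lemma collects them. *)
Lemma spectral_integral_diagZ (phi : R -> R[i]) (c : R[i]) h :
  (spectral_measure E h).-integrable setT (fun l => (complex.Re (phi l))%:E) ->
  (spectral_measure E h).-integrable setT (fun l => (complex.Im (phi l))%:E) ->
  spectral_integral_diag E phi (c *: h) =
  (complex.Re c ^+ 2 + complex.Im c ^+ 2)%:C * spectral_integral_diag E phi h.
Proof.
have k0 : 0 <= complex.Re c ^+ 2 +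
  complex.Im c ^+ 2 by rewrite addr_ge0 ?sqr_ge0.
have main (f : R -> R) : (spectral_measure E h).-integrable setT (EFin \o f) ->
    \int[spectral_measure E (c *: h)]_l f l =
    (complex.Re c ^+ 2 + complex.Im c ^+ 2) * \int[spectral_measure E h]_l f l.
  move=> fi; rewrite /Rintegral.
  rewrite -[complex.Re c ^+ 2 + _]/(fine (complex.Re c ^+ 2 +
    complex.Im c ^+ 2)%:E) -fineM//; last exact: integrable_fin_num.
  congr fine.
  rewrite (@eq_measure_integral _ _ _ _ (mscale (NngNum k0)
    (spectral_measure E h))); last first.
    by move=> A mA _; apply: spectral_measureZ.
  rewrite integralE [in RHS]integralE.
  have mf := measurable_int _ fi.
  rewrite !ge0_integral_mscale//=;
    [|exact: measurable_funeneg|exact: measurable_funepos].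
  by rewrite [RHS]muleBr//; exact: integrable_add_def.
move=> iRe iIm; rewrite /spectral_integral_diag main// main//.
by apply/eqP; rewrite eq_complex/= !mul0r subr0 addr0 !eqxx.
Qed.
End spectral_measure.

(** * Trigonometric polynomials along an orbit *)

Local Notation lineT := (setT : set (measurableTypeR _)).

Section characteristic_function.
Context {R : realType} {H : hilbertType R}.
Context (U : R -> H -> H) (E : spectral_family H).
Hypothesis hU : strongly_continuous_unitary_group U.
Hypothesis hE : spectral_resolution_of U E.
Implicit Types (h : H) (l : seq (R * R)).

Lemma measurable_cosM (t : R) : measurable_fun lineT (fun x : R => cos (t * x)).
Proof.
apply: continuous_measurable_fun => x.
apply: continuous_comp; last exact: continuous_cos.
exact: mulrl_continuous.
Qed.

Lemma measurable_sinM (t : R) : measurable_fun lineT (fun x : R => sin (t * x)).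
Proof.
apply: continuous_measurable_fun => x.
apply: continuous_comp; last exact: continuous_sin.
exact: mulrl_continuous.
Qed.

Lemma bounded_integrable h (f : R -> R) (M : R) :
  measurable_fun lineT f -> (forall x, `|f x| <= M) ->
  (spectral_measure E h).-integrable setT (EFin \o f).
Proof.
move=> mf fM; apply: measurable_bounded_integrable => //.
  by have := spectral_measureT E h; rewrite /= => ->; rewrite ltry.
by exists M; split; [exact: num_real|move=> y My x _ /=;
  exact: le_trans (fM x) (ltW My)].
Qed.

(** With [f = g = h] the polarization formula involves the vectors (1 + i^k)
    h, whose squared moduli 4, 2, 0, 2 weight the terms: the contributions of
    k = 1 and k = 3 cancel and a quarter of the first one remains. *)
Lemma rdot_unitary h t :
  rdot (U t h) h = \int[spectral_measure E h]_x cos (t * x).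
Proof.
have ic : (spectral_measure E h).-integrable setT
  (EFin \o (fun x => cos (t * x))).
  by apply: (@bounded_integrable _ _ 1) => [|x];
    [exact: measurable_cosM|exact: cos_max].
have isn : (spectral_measure E h).-integrable setT
  (EFin \o (fun x => sin (t * x))).
  by apply: (@bounded_integrable _ _ 1) => [|x];
    [exact: measurable_sinM|exact: sin_max].
have hZ (c : R[i]) : h + c *: h = (1 + c) *: h by rewrite scalerDl scale1r.
pose phi (x : R) := cos (t * x) +i* sin (t * x).
rewrite /rdot hE /spectral_integral.
under eq_bigr do rewrite hZ (@spectral_integral_diagZ _ _ _ phi _ _ ic isn).
rewrite !big_ord_recl big_ord0 /=.
by field.
Qed.

Lemma Rintegral_lincomb h (I : Type) (r : seq I) (c : I -> R) 
    (f : I -> R -> R) :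
  (forall i, (spectral_measure E h).-integrable setT (EFin \o f i)) ->
  (spectral_measure E h).-integrable setT
    (EFin \o (fun x => \sum_(i <- r) c i * f i x)) /\
  \int[spectral_measure E h]_x (\sum_(i <- r) c i * f i x) =
  \sum_(i <- r) c i * \int[spectral_measure E h]_x f i x.
Proof.
move=> fi; elim: r => [|i r [IH1 IH2]].
  have -> : (fun x => \sum_(i <- [::]) c i * f i x) = cst 0.
    by apply/funext => x; rewrite big_nil.
  rewrite big_nil; split; first exact: integrable0.
  by rewrite /Rintegral integral0.
have ci : (spectral_measure E h).-integrable setT
  (EFin \o (fun x => c i * f i x)).
  exact: (@integrableZl _ _ _ _ _ measurableT (c i) _ (fi i)).
have consE : (fun x => \sum_(j <- i :: r) c j * f j x) =
    (fun x => c i * f i x + \sum_(j <- r) c j * f j x).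
  by apply/funext => x; rewrite big_cons.
rewrite consE; split.
  exact: (integrableD measurableT ci IH1).
by rewrite RintegralD// IH2 big_cons RintegralZl.
Qed.

Lemma rdot_unitary2 h s t :
  rdot (U s h) (U t h) = \int[spectral_measure E h]_x cos ((s - t) * x).
Proof.
have [hU1 _ hUD _] := hU; have [_ Ut _] := hU1 t.
have {1}-> : s = t + (s - t) by rewrite addrC subrK.
by rewrite -rdot_unitary hUD /rdot /= Ut.
Qed.

(** A list of pairs (coefficient, time) encodes a trigonometric polynomial;
    [trig_vec] is its value on the group, [cos_sum] and [sin_sum] are its real
    and imaginary parts at the frequency [x]. *)
Definition trig_vec h l : H := \sum_(p <- l) p.1%:C *: U p.2 h.
Definition cos_sum l (x : R) : R := \sum_(p <- l) p.1 * cos (p.2 * x).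
Definition sin_sum l (x : R) : R := \sum_(p <- l) p.1 * sin (p.2 * x).

Lemma cos_sin_sum_sqr l x : cos_sum l x ^+ 2 + sin_sum l x ^+ 2 =
  \sum_(p <- l) \sum_(q <- l) p.1 * q.1 * cos ((p.2 - q.2) * x).
Proof.
rewrite !expr2 /cos_sum /sin_sum !mulr_suml -big_split/=; apply: eq_bigr => p _.
rewrite !mulr_sumr -big_split/=; apply: eq_bigr => q _.
rewrite mulrBl cosB; ring.
Qed.

(** The isometry U^t h |-> e^(itx): both sides expand into the same double
    sum, since the Gram matrix of the vectors U^t h has entries (U^s h, U^t h)
    = (U^(s - t) h, h). *)
Lemma hnorm_trig_vec h l : hnorm (trig_vec h l) ^+ 2 =
  \int[spectral_measure E h]_x (cos_sum l x ^+ 2 + sin_sum l x ^+ 2).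
Proof.
have ic t : (spectral_measure E h).-integrable setT
  (EFin \o (fun x => cos (t * x))).
  by apply: (@bounded_integrable _ _ 1) => [|x];
    [exact: measurable_cosM|exact: cos_max].
under eq_Rintegral do rewrite cos_sin_sum_sqr.
transitivity (\sum_(p <- l) \sum_(q <- l) p.1 * q.1 * rdot (U p.2 h) (U q.2 h)).
  rewrite -rdotxx {1}/trig_vec.
  elim: {1 3}l => [|p r IH]; first by rewrite !big_nil /rdot linear0l.
  rewrite !big_cons rdotDl IH; congr (_ + _); rewrite rdotZl /trig_vec.
  elim: {1 2}l => [|q r' IH'];
    first by rewrite !big_nil rdotC /rdot linear0l mulr0.
  by rewrite !big_cons rdotDr mulrDr IH' rdotZr mulrA.
pose c (u : (R * R) * (R * R)) := u.1.1 * u.2.1.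
pose f (u : (R * R) * (R * R)) x := cos ((u.1.2 - u.2.2) * x).
have [_] := @Rintegral_lincomb h _ [seq (p, q) | p <- l, q <- l] c f
  (fun u => ic _).
rewrite big_allpairs/= => e; under eq_Rintegral.
  move=> x _; rewrite (_ : \sum_(p <- l) _ =
    \sum_(i <- [seq (p, q) | p <- l, q <- l]) c i * f i x).
    over.
  by rewrite big_allpairs.
rewrite e; apply: eq_bigr => p _; apply: eq_bigr => q _.
by rewrite rdot_unitary2.
Qed.

End characteristic_function.

(** * Error of scalar Riemann sums *)

Section riemann_scalar.
Context {R : realType}.
Implicit Types (F f : R -> R) (a b d L x : R) (s : seq R) (xi : nat -> R).

Lemma telescope_itv_partition f a b s : itv_partition a b s ->
  \sum_(i < size s) (f (nth b s i) - f (nth b (a :: s) i)) = f b - f a.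
Proof.
elim: s a => [a /itv_partition_nil ->|y s IH a abs];
  first by rewrite big_ord0 subrr.
rewrite big_ord_recl /= (IH y (itv_partition_cons abs)).
by ring.
Qed.

Lemma mean_value F f u v : u <= v -> (forall x : R, is_derive x 1 F (f x)) ->
  exists2 c, u <= c <= v & F v - F u = f c * (v - u).
Proof.
move=> uv dF; have cF : {within `[u, v], continuous F}.
  by apply: derivable_within_continuous => y _;
    exact: (@ex_derive _ _ _ _ _ _ _ (dF y)).
by have [c cuv ->] := @MVT_segment _ F f u v uv (fun y _ => dF y) cF; exists c.
Qed.

Lemma derive_lipschitz F f L p q :
  (forall x : R, is_derive x 1 F (f x)) -> (forall x, `|f x| <= L) ->
  `|F p - F q| <= L * `|p - q|.
Proof.
move=> dF fL; wlog qp : p q / q <= p.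
  move=> W; have [qp|pq] := leP q p; first exact: W.
  by rewrite distrC [in leRHS]distrC; apply: W; exact: ltW.
have [c _ ->] := mean_value qp dF.
by rewrite normrM ler_wpM2r.
Qed.

(** The increment of [F] is (v - u) f y for some y in [u, v], at distance at
    most v - u from [c]. *)
Lemma chord_error F f L u v c : u <= c <= v ->
  (forall x : R, is_derive x 1 F (f x)) ->
  (forall p q, `|f p - f q| <= L * `|p - q|) ->
  `|(v - u) * f c - (F v - F u)| <= L * (v - u) * (v - u).
Proof.
move=> /andP[uc cv] dF fL.
have [y /andP[uy yv] ->] := mean_value (le_trans uc cv) dF.
have vu : 0 <= v - u by lra.
rewrite (mulrC (f y)) -mulrBr normrM (ger0_norm vu) mulrC;
  apply: ler_wpM2r => //.
apply: le_trans (fL c y) _.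
have L0 : 0 <= L.
  have := le_trans (normr_ge0 _) (fL 1 0).
  by rewrite subr0 normr1 mulr1.
by rewrite ler_wpM2l// ler_norml; lra.
Qed.

(** The increments of [F] over the cells telescope, so the error is the sum of
    the errors of the cells. *)
Lemma riemann_error F f L a b d s xi :
  itv_partition a b s ->
  (forall i, (i < size s)%N -> nth b s i - nth b (a :: s) i < d) ->
  (forall i, (i < size s)%N -> nth b (a :: s) i <= xi i <= nth b s i) ->
  (forall x : R, is_derive x 1 F (f x)) ->
  (forall p q, `|f p - f q| <= L * `|p - q|) ->
  `|\sum_(i < size s) (nth b s i - nth b (a :: s) i) * f (xi i) - (F b - F a)|
    <= L * d * (b - a).
Proof.
move=> abs sd sxi dF fL.
rewrite -(telescope_itv_partition F abs) -sumrB.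
apply: le_trans (ler_norm_sum _ _ _) _.
rewrite -(telescope_itv_partition id abs) mulr_sumr; apply: ler_sum => i _.
have /andP[h1 h2] := sxi _ (ltn_ord i).
apply: le_trans (chord_error (sxi _ (ltn_ord i)) dF fL) _.
have L0 : 0 <= L.
  have := le_trans (normr_ge0 _) (fL 1 0).
  by rewrite subr0 normr1 mulr1.
have := sd _ (ltn_ord i) => h3.
by rewrite ler_wpM2r ?ler_wpM2l//; lra.
Qed.

End riemann_scalar.

(** * Riemann sums of the imaginary exponentials *)

Section trig_riemann.
Context {R : realType}.
Implicit Types (a b d x t : R) (s : seq R) (xi : nat -> R).

(** The tagged partitions over which [is_riemann_integral] quantifies. *)
Definition fine_tagging d a b s xi :=
  [/\ itv_partition a b s,
      forall i, (i < size s)%N -> nth b s i - nth b (a :: s) i < d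
    & forall i, (i < size s)%N -> nth b (a :: s) i <= xi i <= nth b s i].

Definition riemann_terms a b s xi : seq (R * R) :=
  [seq (nth b s i - nth b (a :: s) i, xi i) | i <- iota 0 (size s)].

(** Antiderivatives in [t] of cos (t x) and sin (t x); at x = 0 the closed
    formulas degenerate. *)
Definition cos_prim x t : R := if x == 0 then t else sin (t * x) / x.
Definition sin_prim x t : R := if x == 0 then 0 else - (cos (t * x) / x).

Lemma is_derive_scale x t : is_derive t 1 (fun u : R => u * x) x.
Proof.
have := @is_deriveM _ _ id (cst x) t 1 1 0 _ _.
rewrite scaler0 add0r /GRing.scale /= mulr1.
by move=> dM; exact: dM.
Qed.

Lemma is_derive_cos_prim x t : is_derive t 1 (cos_prim x) (cos (t * x)).
Proof.
have [->|x0] := eqVneq x 0.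
  rewrite (_ : cos_prim 0 = id); last by apply/funext => u;
    rewrite /cos_prim eqxx.
  by rewrite mulr0 cos0; exact: is_derive_id.
have dsin : is_derive t 1 (sin \o (fun u => u * x)) (cos (t * x) * x).
  by apply: is_derive1_comp; exact: is_derive_scale.
rewrite (_ : cos_prim x = x^-1 \*: (sin \o (fun u => u * x))); last first.
  by apply/funext => u; rewrite /cos_prim (negbTE x0)/= mulrC.
rewrite (_ : cos (t * x) = x^-1 *: (cos (t * x) * x)); first exact: is_deriveZ.
by rewrite /GRing.scale/= mulrCA mulVf// mulr1.
Qed.

Lemma is_derive_sin_prim x t : is_derive t 1 (sin_prim x) (sin (t * x)).
Proof.
have [->|x0] := eqVneq x 0.
  rewrite (_ : sin_prim 0 = cst 0); last by apply/funext => u;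
    rewrite /sin_prim eqxx.
  by rewrite mulr0 sin0; exact: is_derive_cst.
have dcos : is_derive t 1 (cos \o (fun u => u * x)) (- sin (t * x) * x).
  by apply: is_derive1_comp; exact: is_derive_scale.
rewrite (_ : sin_prim x = (- x^-1) \*: (cos \o (fun u => u * x))); last first.
  by apply/funext => u; rewrite /sin_prim
    (negbTE x0)/= /GRing.scale/= mulNr mulrC.
rewrite (_ : sin (t * x) = (- x^-1) *: (- sin (t * x) * x));
  first exact: is_deriveZ.
by rewrite /GRing.scale/= !mulNr mulrN opprK mulrCA mulVf// mulr1.
Qed.

Lemma cos_lipschitz x p q : `|cos (p * x) - cos (q * x)| <= `|x| * `|p - q|.
Proof.
apply: (@derive_lipschitz _ (fun t => cos (t * x))
  (fun t => - sin (t * x) * x)) => t.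
  exact: (@is_derive1_comp _ cos
    (fun u => u * x) t _ _ (is_derive_cos (t * x)) (is_derive_scale x t)).
by rewrite normrM normrN ler_piMl// sin_max.
Qed.

Lemma sin_lipschitz x p q : `|sin (p * x) - sin (q * x)| <= `|x| * `|p - q|.
Proof.
apply: (@derive_lipschitz _ (fun t => sin (t * x))
  (fun t => cos (t * x) * x)) => t.
  exact: (@is_derive1_comp _ sin
    (fun u => u * x) t _ _ (is_derive_sin (t * x)) (is_derive_scale x t)).
by rewrite normrM ler_piMl// cos_max.
Qed.

Lemma riemann_terms_sum (V : nmodType) (F : R * R -> V) a b s xi :
  \sum_(p <- riemann_terms a b s xi) F p =
  \sum_(i < size s) F (nth b s i - nth b (a :: s) i, xi i).
Proof.
by rewrite big_map -{1}(subn0 (size s)) -/(index_iota _ _) big_mkord.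
Qed.

Lemma riemann_cos_error d a b s xi x : fine_tagging d a b s xi ->
  `|cos_sum (riemann_terms a b s xi) x - (cos_prim x b - cos_prim x a)|
    <= `|x| * d * (b - a).
Proof.
move=> [abs sd sxi]; rewrite /cos_sum riemann_terms_sum.
apply: (@riemann_error _ (cos_prim x) (fun t => cos (t * x))) => //.
- exact: is_derive_cos_prim.
- exact: cos_lipschitz.
Qed.

Lemma riemann_sin_error d a b s xi x : fine_tagging d a b s xi ->
  `|sin_sum (riemann_terms a b s xi) x - (sin_prim x b - sin_prim x a)|
    <= `|x| * d * (b - a).
Proof.
move=> [abs sd sxi]; rewrite /sin_sum riemann_terms_sum.
apply: (@riemann_error _ (sin_prim x) (fun t => sin (t * x))) => //.
- exact: is_derive_sin_prim.
- exact: sin_lipschitz.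
Qed.

Lemma riemann_terms_bound d a b s xi (f : R -> R) : fine_tagging d a b s xi ->
  (forall t, `|f t| <= 1) ->
  `|\sum_(p <- riemann_terms a b s xi) p.1 * f p.2| <= b - a.
Proof.
move=> [abs sd sxi] f1; rewrite riemann_terms_sum.
rewrite -(telescope_itv_partition id abs).
apply: le_trans (ler_norm_sum _ _ _) _; apply: ler_sum => i _ /=.
have /andP[h1 h2] := sxi _ (ltn_ord i).
by rewrite normrM ger0_norm ?ler_piMr//; lra.
Qed.

(** Up to a factor depending on [a] and [b] only, this bounds the squared
    difference of two Riemann sums of mesh at most [d] of t |-> e^(itx). Being
    bounded in [x], it has an integral against every finite measure, and this
    integral tends to 0 with [d]; the Lipschitz bound d |x| need not be
    integrable. *)
Definition clip_sqr d x : R := Num.min (d * `|x|) 1 ^+ 2.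

(** Two estimates of c - c': through the common approximation [C], and through
    the sizes of [c] and [c']. *)
Lemma clip_sqr_bound (c c' C d D x : R) : 0 < d -> 0 <= D ->
  `|c - C| <= `|x| * d * D -> `|c' - C| <= `|x| * d * D ->
  `|c| <= D -> `|c'| <= D ->
  (c - c') ^+ 2 <= 4 * D ^+ 2 * clip_sqr d x.
Proof.
move=> d0 D0 h1 h2 h3 h4.
have -> : 4 * D ^+ 2 * clip_sqr d x = (2 * D * Num.min (d * `|x|) 1) ^+ 2.
  by rewrite /clip_sqr; ring.
rewrite -real_normK ?num_real// ler_pXn2r//; last first.
  by rewrite nnegrE mulr_ge0 ?mulr_ge0// le_min ler01 andbT mulr_ge0// ltW.
have [_|_] := leP (d * `|x|) 1.
  rewrite (_ : c - c' = (c - C) - (c' - C)); last by ring.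
  apply: le_trans (ler_normB _ _) _; apply: le_trans (lerD h1 h2) _.
  by rewrite le_eqVlt; apply/orP; left; apply/eqP; ring.
by apply: le_trans (ler_normB _ _) _; apply: le_trans (lerD h3 h4) _; lra.
Qed.

Lemma fine_tagging_close d a b s xi s' xi' x : 0 < d ->
  fine_tagging d a b s xi -> fine_tagging d a b s' xi' ->
  (cos_sum (riemann_terms a b s xi) x -
    cos_sum (riemann_terms a b s' xi') x) ^+ 2 +
  (sin_sum (riemann_terms a b s xi) x -
    sin_sum (riemann_terms a b s' xi') x) ^+ 2
   <= 8 * (b - a) ^+ 2 * clip_sqr d x.
Proof.
move=> d0 t t'.
have ab : 0 <= b - a by have [/itv_partition_le h _ _] := t; rewrite subr_ge0.
have c1 s1 xi1 : fine_tagging d a b s1 xi1 ->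
  `|cos_sum (riemann_terms a b s1 xi1) x| <= b - a.
  by move=> t1; apply: (riemann_terms_bound t1 (f :=
    fun t => cos (t * x))) => u; exact: cos_max.
have s1 s1 xi1 : fine_tagging d a b s1 xi1 ->
  `|sin_sum (riemann_terms a b s1 xi1) x| <= b - a.
  by move=> t1; apply: (riemann_terms_bound t1 (f :=
    fun t => sin (t * x))) => u; exact: sin_max.
have := clip_sqr_bound d0 ab (riemann_cos_error x t) (riemann_cos_error x t')
  (c1 _ _ t) (c1 _ _ t').
have := clip_sqr_bound d0 ab (riemann_sin_error x t) (riemann_sin_error x t')
  (s1 _ _ t) (s1 _ _ t').
lra.
Qed.

(** The partition of [a, b] into [n.+1] equal cells tagged by their left ends;
    [uniform_tags] at index [n.+1] is the right end [b]. *)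
Definition uniform_nodes a b (n : nat) : seq R :=
  [seq a + (b - a) * i.+1%:R / n.+1%:R | i <- iota 0 n.+1].
Definition uniform_tags a b (n : nat) (i : nat) : R :=
  a + (b - a) * i%:R / n.+1%:R.

Lemma nth_uniform a b n i : (i <= n)%N ->
  nth b (uniform_nodes a b n) i = uniform_tags a b n i.+1.
Proof.
by move=> ni; rewrite (nth_map 0%N) ?size_iota ?ltnS// nth_iota ?add0n.
Qed.

Lemma nth_cons_uniform a b n i : (i <= n)%N ->
  nth b (a :: uniform_nodes a b n) i = uniform_tags a b n i.
Proof.
case: i => [_|i ni] /=; first by rewrite /uniform_tags mulr0 mul0r addr0.
by rewrite nth_uniform// ltnW.
Qed.

Lemma size_uniform a b n : size (uniform_nodes a b n) = n.+1.
Proof. by rewrite size_map size_iota. Qed.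

Lemma uniform_step a b n i : uniform_tags a b n i.+1 - uniform_tags a b n i =
  (b - a) / n.+1%:R.
Proof.
by rewrite /uniform_tags -natr1; field.
Qed.

Lemma uniform_fine_tagging a b d n : a < b -> (b - a) / n.+1%:R < d ->
  fine_tagging d a b (uniform_nodes a b n) (uniform_tags a b n).
Proof.
move=> ab nd.
have st : 0 < (b - a) / n.+1%:R by rewrite divr_gt0 ?subr_gt0.
split.
- split.
    apply/(pathP b) => i; rewrite size_uniform ltnS => ni.
    by rewrite nth_uniform// nth_cons_uniform// -subr_gt0 uniform_step.
  rewrite (last_nth b) size_uniform /= nth_uniform// /uniform_tags.
  by apply/eqP; field.
- move=> i; rewrite size_uniform ltnS => ni.
  by rewrite nth_uniform// nth_cons_uniform// uniform_step.
- move=> i; rewrite size_uniform ltnS => ni.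
  by rewrite nth_uniform// nth_cons_uniform// lexx/= -subr_ge0 uniform_step ltW.
Qed.

End trig_riemann.

(** * The Riemann integral of an orbit *)

Section riemann_unitary.
Context {R : realType} {H : hilbertType R}.
Context (U : R -> H -> H) (E : spectral_family H).
Hypothesis hU : strongly_continuous_unitary_group U.
Hypothesis hE : spectral_resolution_of U E.
Implicit Types (h : H) (l : seq (R * R)) (a b d : R).

Lemma bounded_convergence h (f_ : nat -> R -> R) (f : R -> R) (M : R) :
  (forall n, measurable_fun lineT (f_ n)) ->
  (forall n x, `|f_ n x| <= M) ->
  (forall x, f_ n x @[n --> \oo] --> f x) ->
  (spectral_measure E h).-integrable setT (EFin \o f) /\
  (\int[spectral_measure E h]_x f_ n x) @[n --> \oo] -->
    \int[spectral_measure E h]_x f x.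
Proof.
move=> mf_ f_M f_f.
have mf : measurable_fun lineT (EFin \o f).
  apply/measurable_EFinP; apply: (measurable_fun_cvg mf_) => x _; exact: f_f.
have [||||fi _ cv] := @dominated_convergence _ _ _
  (spectral_measure E h) setT measurableT
   (fun n => EFin \o f_ n) (EFin \o f) (cst M%:E) _ mf.
- by move=> n; apply/measurable_EFinP.
- by apply: aeW => x _ /=; apply: cvg_EFin; [near=> n|exact: f_f].
- apply: (@bounded_integrable _ _ _ h (cst M) `|M|) => //.
- by apply: aeW => x n _ /=; rewrite lee_fin.
split=> //; apply: fine_cvg; rewrite fineK//.
exact: integrable_fin_num.
Unshelve. all: end_near. Qed.

Lemma measurable_cos_sum l : measurable_fun lineT (cos_sum l).
Proof.
rewrite /cos_sum; apply: measurable_sum => p.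
by apply: measurable_funM => //; exact: measurable_cosM.
Qed.

Lemma measurable_sin_sum l : measurable_fun lineT (sin_sum l).
Proof.
rewrite /sin_sum; apply: measurable_sum => p.
by apply: measurable_funM => //; exact: measurable_sinM.
Qed.

Lemma measurable_clip_sqr d : measurable_fun lineT (clip_sqr d).
Proof.
apply: measurable_funX; apply: measurable_minr => //.
by apply: measurable_funM => //; exact: measurableT_comp.
Qed.

Lemma clip_sqr_ge0 d x : 0 <= clip_sqr d x. Proof. exact: sqr_ge0. Qed.

Lemma clip_sqr_le1 d x : 0 <= d -> clip_sqr d x <= 1.
Proof.
move=> d0; rewrite /clip_sqr expr_le1// ?ge_min ?lexx ?orbT//.
by rewrite le_min ler01 mulr_ge0.
Qed.

Lemma clip_sqr_small h e : 0 < e -> exists2 d, 0 < d &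
  \int[spectral_measure E h]_x clip_sqr d x < e.
Proof.
move=> e0.
have [|||_] := @bounded_convergence h (fun n => clip_sqr n.+1%:R^-1) (cst 0) 1.
- by move=> n; exact: measurable_clip_sqr.
- by move=> n x; rewrite ger0_norm ?clip_sqr_ge0// clip_sqr_le1.
- move=> x; apply: (@squeeze_cvgr _ _ _ _ (cst 0)
  (fun n => (n.+1%:R^-1 * `|x|) * (n.+1%:R^-1 * `|x|))).
  + apply: nearW => n; rewrite clip_sqr_ge0/= /clip_sqr -expr2.
    by rewrite ler_pXn2r ?nnegrE ?le_min ?ler01 ?mulr_ge0// ge_min lexx.
  + exact: cvg_cst.
  + have c0 : n.+1%:R^-1 * `|x| @[n --> \oo] --> (0 : R).
      by rewrite -[X in _ --> X](mul0r `|x|); apply: cvgMl; exact: cvg_harmonic.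
    by rewrite -[X in _ --> X](mul0r 0); apply: cvgM.
rewrite Rintegral_cst// mul0r => /cvgr0Pnorm_lt/(_ _ e0)[N _ /(_ _
  (leqnn N))/= hN].
by exists N.+1%:R^-1 => //; exact: le_lt_trans (ler_norm _) hN.
Qed.

Lemma riemann_sum_trig h a b s xi :
  riemann_sum (fun t => U t h) a b s xi = trig_vec U h (riemann_terms a b s xi).
Proof. by rewrite /trig_vec riemann_terms_sum. Qed.

Lemma integrable_clip_sqr h d : 0 <= d ->
  (spectral_measure E h).-integrable setT (EFin \o clip_sqr d).
Proof.
move=> d0; apply: (@bounded_integrable _ _ _ h (clip_sqr d) 1) => [|x].
  exact: measurable_clip_sqr.
by rewrite ger0_norm ?clip_sqr_ge0// clip_sqr_le1.
Qed.

Lemma big_cat_neg (V : nmodType) (F : R * R -> V) l l' :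
  \sum_(p <- l ++ [seq (- p.1, p.2) | p <- l']) F p =
  \sum_(p <- l) F p + \sum_(p <- l') F (- p.1, p.2).
Proof. by rewrite big_cat big_map. Qed.

(** By the isometry, the distance of two Riemann sums of the orbit is the
    L^2-distance of the corresponding scalar Riemann sums. *)
Lemma riemann_sum_close h d a b s xi s' xi' : 0 < d ->
  fine_tagging d a b s xi -> fine_tagging d a b s' xi' ->
  hnorm (riemann_sum (fun t => U t h) a b s xi -
         riemann_sum (fun t => U t h) a b s' xi') ^+ 2 <=
  8 * (b - a) ^+ 2 * \int[spectral_measure E h]_x clip_sqr d x.
Proof.
move=> d0 t t'.
pose l := riemann_terms a b s xi; pose l' := riemann_terms a b s' xi'.
pose m := l ++ [seq (- p.1, p.2) | p <- l'].
have -> : riemann_sum (fun t => U t h) a b s xi -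
          riemann_sum (fun t => U t h) a b s' xi' = trig_vec U h m.
  rewrite !riemann_sum_trig -/l -/l' /trig_vec big_cat_neg -sumrN;
    congr (_ + _).
  by apply: eq_bigr => p _; rewrite rmorphN scaleNr.
have cE x : cos_sum m x = cos_sum l x - cos_sum l' x.
  rewrite /cos_sum big_cat_neg -sumrN; congr (_ + _).
  by apply: eq_bigr => p _; rewrite mulNr.
have sE x : sin_sum m x = sin_sum l x - sin_sum l' x.
  rewrite /sin_sum big_cat_neg -sumrN; congr (_ + _).
  by apply: eq_bigr => p _; rewrite mulNr.
have close x : 0 <= cos_sum m x ^+ 2 +
  sin_sum m x ^+ 2 <= 8 * (b - a) ^+ 2 * clip_sqr d x.
  by rewrite addr_ge0 ?sqr_ge0//= cE sE; exact: fine_tagging_close.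
rewrite (hnorm_trig_vec hU hE) -RintegralZl//;
  last exact/integrable_clip_sqr/ltW.
apply: le_Rintegral => //.
- apply: (@bounded_integrable _ _ _ h _ (8 * (b - a) ^+ 2)) => [|x].
    by apply: measurable_funD; apply: measurable_funX;
      [exact: measurable_cos_sum|exact: measurable_sin_sum].
  have /andP[h0 h1] := close x; rewrite ger0_norm//; apply: le_trans h1 _.
  by apply: ler_piMr; [rewrite mulr_ge0 ?sqr_ge0|apply: clip_sqr_le1;
    exact: ltW].
- exact: (@integrableZl _ _ _ _ _ measurableT (8 * (b - a) ^+ 2) _
    (integrable_clip_sqr h (ltW d0))).
- by move=> x _; have /andP[] := close x.
Qed.

Lemma riemann_sum_cauchy h a b e : 0 < e -> exists2 d, 0 < d &
  forall s xi s' xi', fine_tagging d a b s xi -> fine_tagging d a b s' xi' ->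
  hnorm (riemann_sum (fun t => U t h) a b s xi -
         riemann_sum (fun t => U t h) a b s' xi') < e.
Proof.
move=> e0.
pose K := 8 * (b - a) ^+ 2 + 1.
have K0 : 0 < K by rewrite ltr_wpDl// mulr_ge0// sqr_ge0.
have [|d d0 hd] := @clip_sqr_small h (e ^+ 2 / K);
  first by rewrite divr_gt0// exprn_gt0.
exists d => // s xi s' xi' t t'.
rewrite -(@ltr_pXn2r _ 2)// ?nnegrE ?hnorm_ge0 ?ltW//.
apply: le_lt_trans (riemann_sum_close h d0 t t') _.
have I0 : 0 <= \int[spectral_measure E h]_x clip_sqr d x.
  by apply: Rintegral_ge0 => x _; exact: clip_sqr_ge0.
rewrite ltr_pdivlMr// in hd; apply: le_lt_trans hd.
by rewrite mulrC ler_wpM2l// /K lerDl.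
Qed.

Lemma ltr_div_near (c d : R) : 0 < d -> \forall n \near \oo, c / n.+1%:R < d.
Proof.
move=> d0; have : c * n.+1%:R^-1 @[n --> \oo] --> (0 : R).
  by rewrite -[X in _ --> X](mulr0 c); apply: cvgMr; exact: cvg_harmonic.
move=> /cvgr0Pnorm_lt/(_ _ d0); apply: filterS => n.
by apply: le_lt_trans; exact: ler_norm.
Qed.

(** Completeness provides a limit of the sums over uniform partitions, and
    [riemann_sum_cauchy] compares any fine enough sum with one of these. *)
Lemma riemann_integral_exists h a b : a < b ->
  exists v, is_riemann_integral (fun t => U t h) a b v.
Proof.
move=> ab.
pose S n := riemann_sum
  (fun t => U t h) a b (uniform_nodes a b n) (uniform_tags a b n).
have [|v Sv] := @hilbert_complete _ _ S.
  move=> e e0; have [d d0 hd] := riemann_sum_cauchy h a b e0.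
  have [N _ hN] := ltr_div_near (b - a) d0.
  by exists N => m n Nm Nn; apply: hd; apply: uniform_fine_tagging => //;
    exact: hN.
exists v => e e0.
have e20 : 0 < e / 2 by rewrite divr_gt0.
have [d d0 hd] := riemann_sum_cauchy h a b e20.
exists d => // s xi h1 h2 h3; rewrite normE ltcR.
have [n [n1 n2]] : exists n, (b - a) / n.+1%:R < d /\ hnorm (S n - v) < e / 2.
  have [n hn] := @filter_ex _ \oo _ _
    (filterI (ltr_div_near (b - a) d0) ((cvg_hnorm _ _).1 Sv _ e20)).
  by exists n.
have := hnormD (riemann_sum (fun t => U t h) a b s xi - S n) (S n - v).
rewrite addrA subrK => /le_lt_trans; apply.
rewrite [e]splitr ltrD//; apply: hd => //.
exact: uniform_fine_tagging.
Qed.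

(** The isometry for the sums over uniform partitions passes to the limit: the
    scalar sums converge pointwise to the integral of e^(itx) over [a, b] and
    are bounded uniformly in [x]. *)
Lemma riemann_integral_norm h a b v : a < b ->
  is_riemann_integral (fun t => U t h) a b v ->
  (spectral_measure E h).-integrable setT (EFin \o (fun x =>
     (cos_prim x b - cos_prim x a) ^+ 2 +
       (sin_prim x b - sin_prim x a) ^+ 2)) /\
  hnorm v ^+ 2 = \int[spectral_measure E h]_x
     ((cos_prim x b - cos_prim x a) ^+ 2 + (sin_prim x b - sin_prim x a) ^+ 2).
Proof.
move=> ab iv.
pose l n := riemann_terms a b (uniform_nodes a b n) (uniform_tags a b n).
have Sv : trig_vec U h (l n) @[n --> \oo] --> v.
  apply/cvg_hnorm => e e0; have [d d0 hd] := iv e e0.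
  apply: filterS (ltr_div_near (b - a) d0) => n hn.
  rewrite -ltcR -normE -riemann_sum_trig.
  by have [] := uniform_fine_tagging ab hn; exact: hd.
pose d n : R := 2 * (b - a) / n.+1%:R.
have tn n : fine_tagging (d n) a b (uniform_nodes a b n) (uniform_tags a b n).
  apply: uniform_fine_tagging => //; rewrite /d -mulrA ltr_pMl ?ltr1n//.
  by rewrite divr_gt0 ?subr_gt0.
have dn x : `|x| * d n * (b - a) @[n --> \oo] --> (0 : R).
  rewrite (_ : (fun _ => _) =
    (fun n => (`|x| * (2 * (b - a)) * (b - a)) * n.+1%:R^-1)).
    by rewrite -[X in _ --> X](mulr0 (`|x| * (2 * (b - a)) * (b - a)));
      apply: cvgMr; exact: cvg_harmonic.
  by apply/funext => n; rewrite /d; ring.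
have approx (f : nat -> R) (c : R) (g : nat -> R) :
    (forall n, `|f n - c| <= g n) -> g n @[n --> \oo] --> (0 : R) ->
      f n @[n --> \oo] --> c.
  move=> fg g0; apply/cvgrPdist_lt => e e0.
  move: g0 => /cvgr0Pnorm_lt/(_ _ e0); apply: filterS => n; apply: le_lt_trans.
  by rewrite distrC; apply: le_trans (fg n) _; exact: ler_norm.
have ccv x : cos_sum (l n) x @[n --> \oo] --> cos_prim x b - cos_prim x a.
  apply: (approx (fun n => cos_sum (l n) x) _
    (fun n => `|x| * d n * (b - a))) => [n|]; last exact: dn.
  exact: riemann_cos_error.
have scv x : sin_sum (l n) x @[n --> \oo] --> sin_prim x b - sin_prim x a.
  apply: (approx (fun n => sin_sum (l n) x) _
    (fun n => `|x| * d n * (b - a))) => [n|]; last exact: dn.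
  exact: riemann_sin_error.
have [|||fi cv] := @bounded_convergence h
  (fun n x => cos_sum (l n) x ^+ 2 + sin_sum (l n) x ^+ 2)
  (fun x => (cos_prim x b - cos_prim x a) ^+ 2 +
    (sin_prim x b - sin_prim x a) ^+ 2)
  (2 * (b - a) ^+ 2).
- by move=> n; apply: measurable_funD; apply: measurable_funX;
      [exact: measurable_cos_sum|exact: measurable_sin_sum].
- move=> n x; rewrite ger0_norm ?addr_ge0 ?sqr_ge0//.
  have h1 := riemann_terms_bound (tn n) (f :=
    fun t => cos (t * x)) (fun u => cos_max _).
  have h2 := riemann_terms_bound (tn n) (f :=
    fun t => sin (t * x)) (fun u => sin_max _).
  rewrite mulr2n mulrDl mul1r lerD// -[leLHS]real_normK ?num_real// ler_pXn2r//
    ?nnegrE ?subr_ge0//; exact: ltW.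
- by move=> x; rewrite !expr2; under eq_fun do rewrite !expr2; apply: cvgD;
  apply: cvgM.
split=> //.
have := cvg_hnorm_sqr Sv.
rewrite (_ : (fun n => _) = (fun n => \int[spectral_measure E h]_x
    (cos_sum (l n) x ^+ 2 + sin_sum (l n) x ^+ 2))); last first.
  by apply/funext => n; exact: hnorm_trig_vec.
by move=> /cvg_unique; apply.
Qed.

End riemann_unitary.

(** * The spectral measure of the point 0 *)

Section spectral_atom.
Context {R : realType} {H : hilbertType R}.
Context (U : R -> H -> H) (E : spectral_family H).
Hypothesis hU : strongly_continuous_unitary_group U.
Hypothesis hE : spectral_resolution_of U E.
Implicit Types (h x y v : H) (l m : R).

Lemma spectral_familyB l x y : E l (x - y) = E l x - E l y.
Proof.
have [El_lin _ _] := sf_proj E l.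
by rewrite -[x - y]addrC -scaleN1r El_lin scaleN1r addrC.
Qed.

Lemma spectral_family_rdot l x y : rdot (E l x) y = rdot x (E l y).
Proof. by have [_ _ h] := sf_proj E l; rewrite /rdot h. Qed.

Lemma spectral_family_diff h l m : l <= m ->
  hnorm (E m h - E l h) ^+ 2 =
    spectral_distribution E h m - spectral_distribution E h l.
Proof.
move=> lm; apply: (@complexI R).
by rewrite -spectral_distributionB// normE -rmorphXn.
Qed.

Lemma spectral_family_contract l x : hnorm (E l x) <= hnorm x.
Proof.
have [_ Eid _] := sf_proj E l.
rewrite -(@ler_pXn2r _ 2)// ?nnegrE ?hnorm_ge0//.
have := sqr_ge0 (hnorm (x - E l x)); rewrite hnormB_sqr.
have -> : rdot x (E l x) = hnorm (E l x) ^+ 2.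
  by rewrite -rdotxx spectral_family_rdot Eid.
lra.
Qed.

(** A sequence of negative numbers increasing to 0. *)
Let q (n : nat) : R := - n.+1%:R^-1.

(** Continuity from above along the intervals ]-1/(n+1), 0]. *)
Lemma spectral_measure_atom h (L : R) :
  spectral_distribution E h 0 -
    spectral_distribution E h (q n) @[n --> \oo] --> L ->
  spectral_measure E h [set 0] = L%:E.
Proof.
move=> FL; rewrite set1_bigcap_oc.
pose I n : set R := `]0 - n.+1%:R^-1, 0]%classic.
have IE n : spectral_measure E h (I n) =
    (spectral_distribution E h 0 - spectral_distribution E h (q n))%:E.
  by rewrite /I sub0r spectral_measure_ocitv// /q oppr_le0.
have : (spectral_measure E h \o I) n @[n --> \oo] --> spectral_measure E h
  (\bigcap_n I n).
  apply: nonincreasing_cvg_mu => //.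
  - by have /= -> := IE 0%N; rewrite ltry.
  - by move=> n; exact: measurable_itv.
  - by apply: bigcap_measurable => // n _; exact: measurable_itv.
  - move=> m n mn; apply/subsetPset/subset_itv; rewrite // leBSide/=.
    by rewrite lerB// lef_pV2 ?posrE// ler_nat.
have -> : spectral_measure E h \o I = (fun n =>
    (spectral_distribution E h 0 - spectral_distribution E h (q n))%:E).
  by apply/funext => n /=; rewrite -IE.
move=> /cvg_unique; apply; first exact: ereal_hausdorff.
by apply: cvg_EFin; [near=> n|].
Unshelve. all: end_near. Qed.

(** For l <= m the squared distance of E l h and E m h is the increment of the
    distribution function, which is bounded and monotone; so E (q n) h is
    Cauchy. *)
Lemma spectral_left_limit h : exists w : H, E (q n) h @[n --> \oo] --> w.
Proof.
apply: hilbert_complete => e e0.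
have qS (m n : nat) : (m <= n)%N -> q m <= q n.
  by move=> mn; rewrite lerN2 lef_pV2 ?posrE// ler_nat.
have : cvg (spectral_distribution E h (q n) @[n --> \oo]).
  apply: nondecreasing_is_cvgn.
    by move=> m n /qS; exact: spectral_distribution_nd.
  exists (spectral_distribution E h 0) => _ [n _ <-].
  by apply: spectral_distribution_nd; rewrite oppr_le0.
move=> /cvgrPdist_lt/(_ (e ^+ 2 / 2)).
rewrite divr_gt0 ?exprn_gt0// => /(_ isT)[N _ hN].
exists N => m n; wlog nm : m n / (n <= m)%N.
  move=> W Nm Nn; have [nm|/ltnW mn] := leqP n m; first exact: W.
  by rewrite hdistC; exact: W.
move=> Nm Nn; rewrite -(@ltr_pXn2r _ 2)// ?nnegrE ?hnorm_ge0 ?ltW//.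
rewrite spectral_family_diff ?qS//.
have := hN m Nm; have := hN n Nn; rewrite /= !ltr_norml; lra.
Qed.

(** The spectral measure of [v] is a point mass at 0, so (U^t v, v) = |v|^2,
    and the equality case of the Cauchy-Schwarz inequality forces U^t v = v.
    *)
Lemma concentrated_fixed v :
  (forall l, 0 <= l -> E l v = v) -> (forall l, l < 0 -> E l v = 0) ->
  fixed_space U v.
Proof.
move=> Epos Eneg t.
have Fv n : spectral_distribution E v 0 - spectral_distribution E v (q n) =
  hnorm v ^+ 2.
  rewrite -spectral_family_diff ?oppr_le0// Epos// Eneg ?subr0//.
  by rewrite /q oppr_lt0.
have v0 : spectral_measure E v [set 0] = (hnorm v ^+ 2)%:E.
  apply: spectral_measure_atom; under eq_fun do rewrite Fv; exact: cvg_cst.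
have vC : spectral_measure E v (~` [set 0]) = 0%E.
  have h : (spectral_measure E v (~` [set 0%R]) +
    spectral_measure E v [set 0%R] =
      (hnorm v ^+ 2)%R%:E)%E.
    rewrite -(spectral_measureT E) -[in RHS](setvU [set (0 : R)]).
    by apply/esym/measureU; [exact: measurableC| |rewrite setICl].
  move: h; rewrite v0; case: (spectral_measure E v _) => [r| |]//.
  by rewrite -EFinD => -[rv]; congr EFin; lra.
have tv : rdot (U t v) v = hnorm v ^+ 2.
  rewrite (rdot_unitary hE) /Rintegral (ae_eq_integral (cst 1%E)) //.
  - by rewrite integral_cst// mul1e; have := spectral_measureT E v;
    rewrite /= => ->.
  - by apply/measurable_EFinP; exact: measurable_cosM.
  exists (~` [set 0]); split; [exact: measurableC|exact: vC|].
  by move=> x /= xn x0; apply: xn => _; rewrite x0 mulr0 cos0.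
apply: subr0_eq; apply: hnorm_eq0; apply/eqP.
have [hU1 _ _ _] := hU; have [_ Ut _] := hU1 t.
have UtN : hnorm (U t v) ^+ 2 = hnorm v ^+ 2 by rewrite -!rdotxx /rdot Ut.
by rewrite -sqrf_eq0 hnormB_sqr tv UtN; apply/eqP; ring.
Qed.

(** Let [v] be the jump at 0 of l |-> E l h, that is the limit of v_n = E 0 h
    - E (q n) h. It is concentrated at 0, hence fixed, hence orthogonal to
    [h]; as E 0 v = v and E (q n) v = 0, it is orthogonal to each v_n. Since
    |v_n - v|^2 = |v_n|^2 + |v|^2 tends to 0, so does |v_n|^2, which is the
    measure of ]-1/(n+1), 0]. *)
Lemma spectral_measure_atom0 h :
  (forall v, fixed_space U v -> rdot v h = 0) ->
  spectral_measure E h [set 0] = 0%E.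
Proof.
move=> hfix.
have [w qw] := spectral_left_limit h.
pose v_ n := E 0 h - E (q n) h; pose v := E 0 h - w.
have vE : v_ n @[n --> \oo] --> v by apply: cvgB => //; exact: cvg_cst.
have Evn l n : E l (v_ n) = E (Num.min l 0) h - E (Num.min l (q n)) h.
  by rewrite spectral_familyB !sf_min.
have Ecv l : E l (v_ n) @[n --> \oo] --> E l v.
  apply/cvg_hnorm => e e0; move/cvg_hnorm: vE => /(_ _ e0); apply: filterS => n.
  by apply: le_lt_trans; rewrite -spectral_familyB;
    exact: spectral_family_contract.
have q0 n : q n < 0 by rewrite oppr_lt0.
have Epos l : 0 <= l -> E l v = v.
  move=> l0; apply: (cvg_unique _ (Ecv l)); first exact: norm_hausdorff.
  rewrite (_ : (fun n => _) = v_)//; apply/funext => n; rewrite Evn min_r//.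
  by rewrite min_r// (le_trans _ l0)// ltW.
have Eneg l : l < 0 -> E l v = 0.
  move=> l0; apply: (cvg_unique _ (Ecv l)); first exact: norm_hausdorff.
  apply: cvg_near_cst.
  have := @cvg_harmonic R => /cvgrPdist_le/(_ (- l));
    rewrite oppr_gt0 => /(_ l0).
  apply: filterS => n; rewrite sub0r normrN => /(le_trans (ler_norm _)) h1.
  have ql : l <= q n by rewrite lerNr.
  by rewrite Evn (min_l (ltW l0)) (min_l ql) subrr.
have vh : rdot v h = 0 by apply: hfix; exact: concentrated_fixed.
have vv n : rdot v (v_ n) = 0.
  rewrite /v_ rdotDr rdotNr -!spectral_family_rdot Epos// Eneg// vh.
  by rewrite /rdot linear0l subr0.
apply: spectral_measure_atom.
under eq_fun do rewrite -spectral_family_diff ?ltW//.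
have d0 : hnorm (v_ n - v) ^+ 2 @[n --> \oo] --> (0 : R).
  have -> : 0 = hnorm (0 : H) ^+ 2 by rewrite /hnorm normr0 expr0n.
  apply: cvg_hnorm_sqr; rewrite -[X in _ --> X](subrr v); apply: cvgB => //.
  exact: cvg_cst.
apply: (squeeze_cvgr _ (cvg_cst 0) d0); apply: nearW => n.
by rewrite sqr_ge0/= -/(v_ n) [leRHS]hnormB_sqr (rdotC
  (v_ n)) vv mulr0 subr0 lerDl sqr_ge0.
Qed.

End spectral_atom.

(** * Rates of convergence of the ergodic averages *)

Section ergodic.
Context {R : realType} {H : hilbertType R}.
Context (U : R -> H -> H) (E : spectral_family H).
Hypothesis hU : strongly_continuous_unitary_group U.
Hypothesis hE : spectral_resolution_of U E.
Implicit Types (f g p h v : H) (a b d s t x : R).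

(** The squared modulus of the integral of t |-> e^(itx) over [a, b]. *)
Definition exp_energy a b x : R :=
  (cos_prim x b - cos_prim x a) ^+ 2 + (sin_prim x b - sin_prim x a) ^+ 2.

Lemma exp_energyE a b x : x != 0 ->
  exp_energy a b x = (2 - 2 * cos ((b - a) * x)) * x ^- 2.
Proof.
move=> x0; rewrite /exp_energy /cos_prim /sin_prim (negbTE x0)
  (mulrBl x b a) cosB.
have := cos2Dsin2 (b * x); have := cos2Dsin2 (a * x).
move: (cos (b * x)) (sin (b * x)) (cos (a * x)) (sin
  (a * x)) => cb sb ca sa ea eb.
transitivity (((ca ^+ 2 + sa ^+ 2) + (cb ^+ 2 + sb ^+ 2) - 2 * (cb * ca +
  sb * sa)) * x ^- 2).
  by field.
by rewrite ea eb; ring.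
Qed.

(** On the orbit of a fixed vector every Riemann sum has the exact value (t-s)
    p. *)
Lemma is_riemann_integral_subfixed f p s t v : s < t -> fixed_space U p ->
  is_riemann_integral (fun u => U u f) s t v ->
  is_riemann_integral (fun u => U u (f - p)) s t (v - (t - s)%:C *: p).
Proof.
move=> st pfix iv e e0; have [d d0 hd] := iv e e0; exists d => // r xi h1 h2 h3.
suff -> : riemann_sum (fun u => U u (f - p)) s t r xi - (v - (t - s)%:C *: p) =
          riemann_sum (fun u => U u f) s t r xi - v by exact: hd.
rewrite opprB addrA; congr (_ - _).
rewrite -(telescope_itv_partition id h1) rmorph_sum scaler_suml -big_split/=.
apply: eq_bigr => i _; have [hU1 _ _ _] := hU; have [Ulin _ _] := hU1 (xi i).
rewrite -scalerDr; congr (_ *: _).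
by rewrite -[f - p]addrC -scaleN1r Ulin pfix scaleN1r addrAC addNr add0r.
Qed.

(** Subtracting [p] from the average amounts to averaging the orbit of [f-p],
    to which [riemann_integral_norm] applies. *)
Lemma ergodic_average_energy f p s t : s < t -> fixed_space U p ->
  (spectral_measure E (f - p)).-integrable setT (EFin \o exp_energy s t) /\
  `|ergodic_average U t s f - p| ^+ 2 =
  ((t - s) ^- 2 * \int[spectral_measure E (f - p)]_x exp_energy s t x)%:C.
Proof.
move=> st pfix.
have iv : is_riemann_integral (fun u => U u f) s t (riemann_integral
  (fun u => U u f) s t).
  by apply: xgetPex; exact: (riemann_integral_exists hU hE).
have [ie <-] := riemann_integral_norm hU hE st
  (is_riemann_integral_subfixed st pfix iv).
split=> //; rewrite normE -rmorphXn; congr (_%:C).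
have ts0 : t - s != 0 by rewrite subr_eq0 gt_eqF.
rewrite /ergodic_average.
set v := riemann_integral _ _ _.
have -> : ((t - s)^-1)%:C *: v - p = ((t - s)^-1)%:C *: (v - (t - s)%:C *: p).
  by rewrite scalerBr scalerA -rmorphM/= mulVf// scale1r.
by rewrite hnormZ exprMn real_normK ?num_real// exprVn.
Qed.

Lemma complement_orth (P : H -> H) f v :
  orthogonal_projection_onto (fixed_space U) P -> fixed_space U v ->
    rdot v (f - P f) = 0.
Proof.
move=> [[_ Pid Psa] rP] vfix.
have : range P v by rewrite rP.
move=> [y _ yv]; rewrite rdotDr rdotNr.
have -> : rdot v (P f) = rdot v f by rewrite /rdot -Psa -yv Pid.
by rewrite subrr.
Qed.

Lemma measurable_expVn2 : measurable_fun lineT (fun x : R => x ^- 2).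
Proof.
rewrite (_ : (fun x : R => x ^- 2) = (fun x => x^-1 ^+ 2)); last first.
  by apply/funext => x; rewrite exprVn.
apply: measurable_funX.
rewrite -(setvU [set (0 : R)]); apply/measurable_funU => //;
  first exact: measurableC.
split; last exact: measurable_fun_set1.
apply: open_continuous_measurable_fun.
  by apply: closed_openC; exact: closed_eq.
by move=> x; rewrite inE /= => /eqP x0; exact: inv_continuous.
Qed.

Lemma expVn2_ge0 x : 0 <= x ^- 2.
Proof. by rewrite invr_ge0 sqr_ge0. Qed.

Lemma exp_energy_ge0 s t x : 0 <= exp_energy s t x.
Proof. by rewrite addr_ge0 ?sqr_ge0. Qed.

Lemma exp_energy_le s t x : x != 0 -> exp_energy s t x <= 4 * x ^- 2.
Proof.
move=> x0; rewrite exp_energyE// ler_wpM2r ?expVn2_ge0//.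
by have := cos_geN1 ((t - s) * x); lra.
Qed.

(** The pointwise bound 4 x^-2 fails at x = 0 only, which is a null point. *)
Lemma ergodic_rate_upper g (A : R) s t :
  spectral_measure E g [set 0] = 0%E ->
  (spectral_measure E g).-integrable setT (EFin \o exp_energy s t) ->
  (\int[spectral_measure E g]_x (x ^- 2)%R%:E = A%:E)%E ->
  \int[spectral_measure E g]_x exp_energy s t x <= 4 * A.
Proof.
move=> g0 ie gA; rewrite -lee_fin /Rintegral fineK;
  last exact: integrable_fin_num.
rewrite EFinM -gA -ge0_integralZl_EFin//; last 2 first.
- by move=> x _; rewrite lee_fin expVn2_ge0.
- by apply/measurable_EFinP; exact: measurable_expVn2.
apply: ae_ge0_le_integral => //.
- by move=> x _; rewrite lee_fin exp_energy_ge0.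
- exact: measurable_int ie.
- by move=> x _; rewrite -EFinM lee_fin mulr_ge0// expVn2_ge0.
- apply/measurable_EFinP; apply: measurable_funM => //;
  exact: measurable_expVn2.
exists [set 0]; split => // x /= /not_implyP[_]; apply: contra_notP => /eqP x0.
by rewrite -EFinM lee_fin exp_energy_le.
Qed.

(** The energy of the interval [0, t] away from x = 0; at x = 0 it takes the
    value 0, in agreement with 0 ^- 2 = 0. *)
Definition deficit t x : R := (2 - 2 * cos (t * x)) * x ^- 2.

Lemma deficit_ge0 t x : 0 <= deficit t x.
Proof. by rewrite mulr_ge0 ?expVn2_ge0//; have := cos_le1 (t * x); lra. Qed.

Lemma measurable_deficit t : measurable_fun lineT (deficit t).
Proof.
apply: measurable_funM; last exact: measurable_expVn2.
by apply: measurable_funB => //; apply: measurable_funM => //;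
  exact: measurable_cosM.
Qed.

Lemma cos_sum_uniform a b (n : nat) x :
  cos_sum (riemann_terms a b (uniform_nodes a b n) (uniform_tags a b n)) x =
  (b - a) / n.+1%:R * \sum_(i < n.+1) cos (uniform_tags a b n i * x).
Proof.
rewrite /cos_sum riemann_terms_sum size_uniform mulr_sumr;
  apply: eq_bigr => i _ /=.
have ni : (i <= n)%N by rewrite -ltnS ltn_ord.
by rewrite (nth_uniform _ _ ni) (nth_cons_uniform _ _ ni) uniform_step.
Qed.

(** The average of the deficits at times equally spaced over [0, k+1] with
    step less than 1/(k+1): the window grows while the mesh shrinks. For a
    single time, or for a fixed step, the deficits vanish at some nonzero
    frequencies. *)
Definition mean_deficit (k : nat) x : R :=
  (k.+1 * k.+1).+1%:R^-1 *
  \sum_(i < (k.+1 * k.+1).+1) deficit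
    (uniform_tags 0 k.+1%:R (k.+1 * k.+1) i) x.

(** For x <> 0 the mean of cos (t x) over the chosen times is a Riemann sum of
    t |-> cos (t x) over [0, k+1] divided by k+1. The integral is bounded by
    1/|x| and the error of the sum by 2|x|, so that the quotient is
    O(1/(k+1)). *)
Lemma mean_deficit_cvg x : mean_deficit k x @[k --> \oo] --> 2 * x ^- 2.
Proof.
have [->|x0] := eqVneq x 0.
  have -> : (fun k => mean_deficit k 0) = cst 0.
    apply/funext => k; rewrite /mean_deficit big1 ?mulr0// => i _.
    by rewrite /deficit expr0n/= invr0 mulr0.
  by rewrite expr0n/= invr0 mulr0; exact: cvg_cst.
pose c k := cos_sum (riemann_terms 0 k.+1%:R
  (uniform_nodes 0 k.+1%:R (k.+1 * k.+1))
                (uniform_tags 0 k.+1%:R (k.+1 * k.+1))) x.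
have mE k : mean_deficit k x = 2 * x ^- 2 - 2 * x ^- 2 * (c k / k.+1%:R).
  rewrite /mean_deficit /c cos_sum_uniform.
  set N := (k.+1 * k.+1)%N.
  have M0 : k.+1%:R != 0 :> R by rewrite pnatr_eq0.
  have N0 : N.+1%:R != 0 :> R by rewrite pnatr_eq0.
  rewrite -mulr_suml sumrB sumr_const card_ord -mulr_sumr subr0
    -[2 *+ N.+1]mulr_natr.
  move: (\sum_(i < N.+1) _) => S; move: (N.+1%:R) N0 (k.+1%:R) M0 => N' N0 M M0.
  by field; apply/and3P; split.
have cb k : `|c k / k.+1%:R| <= (2 * `|x| + 2 * `|x|^-1) * k.+1%:R^-1.
  set M : R := k.+1%:R; have M0 : 0 < M by rewrite ltr0n.
  have step : (M - 0) / (k.+1 * k.+1).+1%:R < 2 / M.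
    have -> : (k.+1 * k.+1).+1%:R = M * M + 1 by rewrite -natr1 natrM.
    have MM : 0 < M * M by exact: mulr_gt0.
    rewrite subr0 ltr_pdivrMr; last exact: addr_gt0.
    by rewrite mulrAC ltr_pdivlMr//; lra.
  have := riemann_cos_error x (uniform_fine_tagging M0 step).
  rewrite -/M -/(c k) => err.
  have prim : `|cos_prim x M - cos_prim x 0| <= `|x|^-1.
    rewrite /cos_prim (negbTE x0) mul0r sin0 mul0r subr0 normrM normfV.
    by rewrite ler_piMl ?invr_ge0// sin_max.
  have x1 : 0 < `|x|^-1 by rewrite invr_gt0 normr_gt0.
  have ck : `|c k| <= 2 * `|x| + 2 * `|x|^-1.
    have := lerD err prim; 
    have := ler_normD (c k - (cos_prim x M - cos_prim x 0))
      (cos_prim x M - cos_prim x 0).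
    have -> : `|x| * (2 / M) * (M - 0) = 2 * `|x|.
      by rewrite subr0 -mulrA divfK ?gt_eqF// mulrC.
    by rewrite subrK; lra.
  by rewrite normrM ler_pM// normfV gtr0_norm.
have ccv : c k / k.+1%:R @[k --> \oo] --> (0 : R).
  apply/norm_cvg0P; apply: (@squeeze_cvgr _ _ _ _ (cst 0)
    (fun k => (2 * `|x| + 2 * `|x|^-1) * k.+1%:R^-1)); last 2 first.
  - exact: cvg_cst.
  - rewrite -[X in _ --> X](mulr0 (2 * `|x| + 2 * `|x|^-1)).
    by apply: cvgMr; exact: cvg_harmonic.
  by apply: nearW => k; apply/andP; split; [exact: normr_ge0|exact: cb].
rewrite (_ : (fun k => _) =
  (fun k => 2 * x ^- 2 - 2 * x ^- 2 * (c k / k.+1%:R))); last first.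
  by apply/funext => k; rewrite mE.
rewrite -[X in _ --> X]subr0 -[X in _ - X](mulr0 (2 * x ^- 2)).
by apply: cvgB; [exact: cvg_cst|apply: cvgMr].
Qed.

(** The integrals of the means of deficits are at most [B], and these means
    converge to 2 x^-2 at every [x]; conclude with the lemma of Fatou. *)
Lemma ergodic_rate_lower g (B : R) : 0 < B ->
  (forall t, 0 < t -> (spectral_measure E g).-integrable setT
    (EFin \o exp_energy 0 t)) ->
  (forall t, 0 < t -> \int[spectral_measure E g]_x exp_energy 0 t x <= B) ->
  (\int[spectral_measure E g]_x (2 * x ^- 2)%R%:E <= B%:E)%E.
Proof.
move=> B0 ie hB.
have dB t : 0 <= t -> (\int[spectral_measure E g]_x (deficit t x)%:E <= B%:E)%E.
  (* The tag 0 of the uniform partition is among the averaged times. *)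
  rewrite le_eqVlt => /orP[/eqP <-|t0].
    under eq_integral do rewrite /deficit mul0r cos0 mulr1 subrr mul0r.
    by rewrite integral0 lee_fin ltW.
  apply: le_trans (_ : _ <=
    (\int[spectral_measure E g]_x exp_energy 0 t x)%:E)%E _; last first.
    by rewrite lee_fin hB.
  rewrite /Rintegral fineK; last by apply: integrable_fin_num => //; exact: ie.
  apply: ge0_le_integral => //.
  - by move=> x _; rewrite lee_fin deficit_ge0.
  - by apply/measurable_EFinP; exact: measurable_deficit.
  - exact: measurable_int (ie _ t0).
  - move=> x _; rewrite lee_fin; have [->|x0] := eqVneq x 0.
      by rewrite /deficit expr0n/= invr0 mulr0 exp_energy_ge0.
    by rewrite exp_energyE// subr0.
have mdB k : (\int[spectral_measure E g]_x (mean_deficit k x)%:E <= B%:E)%E.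
  rewrite /mean_deficit; set N := (k.+1 * k.+1)%N.
  under eq_integral do rewrite EFinM -sumEFin.
  rewrite ge0_integralZl_EFin ?invr_ge0//; last 2 first.
  - by move=> x _; apply: sume_ge0 => i _; rewrite lee_fin deficit_ge0.
  - by apply: emeasurable_sum => i; apply/measurable_EFinP;
    exact: measurable_deficit.
  rewrite ge0_integral_sum//; last 2 first.
  - by move=> i; apply/measurable_EFinP; exact: measurable_deficit.
  - by move=> i x _; rewrite lee_fin deficit_ge0.
  rewrite -[leRHS]mul1e -[X in (_ <= X%:E * _)%E](@mulVf _
    (N.+1%:R)) ?pnatr_eq0//.
  rewrite EFinM -muleA; apply: lee_wpmul2l; first by rewrite lee_fin invr_ge0.
  apply: le_trans (_ : _ <= \sum_(i < N.+1) B%:E)%E _.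
    apply: lee_sum => i _; apply: dB.
    by rewrite /uniform_tags add0r subr0 !mulr_ge0// invr_ge0.
  by rewrite sumEFin sumr_const card_ord -EFinM mulr_natl.
rewrite (_ : (fun x => (2 * x ^- 2)%R%:E) = (fun x => limn_einf
  (fun k => (mean_deficit k x)%:E))); last first.
  apply/funext => x; apply/esym.
  have cv : (mean_deficit k x)%:E @[k --> \oo] --> (2 * x ^- 2)%R%:E.
    by apply: cvg_EFin; [near=> k|exact: mean_deficit_cvg].
  by rewrite (cvg_limn_einf_sup cv).
apply: le_trans.
  apply: fatou => //.
  - move=> k; apply/measurable_EFinP; apply: measurable_funM => //.
    by apply: measurable_sum => i; exact: measurable_deficit.
  - move=> k x _; rewrite lee_fin mulr_ge0 ?invr_ge0// sumr_ge0// => i _.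
    exact: deficit_ge0.
rewrite limn_einf_lim; apply: lime_le; first exact: is_cvg_einfs.
apply: nearW => k; apply: le_trans (mdB k).
by apply: ereal_inf_lbound; exists k => /=.
Unshelve. all: end_near. Qed.

End ergodic.

Unset Implicit Arguments.

Theorem mainTheorem2 (R : realType) (H : hilbertType R) (U : R -> H -> H)
    (E : spectral_family H) (P : H -> H)
    (hU : strongly_continuous_unitary_group U)
    (hE : spectral_resolution_of U E)
    (hP : orthogonal_projection_onto (fixed_space U) P)
    (f : H) :
  (forall A : R,
     (\int[spectral_measure E (f - P f)%R]_x (x ^- 2)%R%:E = A%:E)%E ->
     forall s t : R, s < t ->
       `|ergodic_average U t s f - P f| ^+ 2 <= (4 * A * (t - s) ^- 2)%:C) /\
  (forall B : R, 0 < B ->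
     (forall s t : R, s < t ->
       `|ergodic_average U t s f - P f| ^+ 2 <= (B * (t - s) ^- 2)%:C) ->
     (\int[spectral_measure E (f - P f)%R]_x (x ^- 2)%R%:E <= (8 * B)%R%:E)%E).
Proof.
have pfix : fixed_space U (P f) by have [_ <-] := hP; exists f.
have energy s t st := @ergodic_average_energy _ _ _ _ hU hE f (P f) s t st pfix.
split=> [A gA s t st|B B0 hB].
  have [ie ->] := energy s t st.
  rewrite lecR mulrC ler_wpM2r ?invr_ge0 ?sqr_ge0//.
  apply: ergodic_rate_upper => //.
  apply: (spectral_measure_atom0 hU hE) => v vfix.
  exact: complement_orth hP vfix.
have dom : (\int[spectral_measure E (f - P f)%R]_x (2 * x ^- 2)%R%:E <= B%:E)%E.
  apply: ergodic_rate_lower => // t t0; first exact: (energy 0 t t0).1.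
  have := hB 0 t t0; rewrite (energy 0 t t0).2 lecR mulrC.
  by rewrite ler_pM2r// invr_gt0 exprn_gt0// subr_gt0.
apply: (@le_trans _ _ B%:E); last by rewrite lee_fin; lra.
apply: le_trans dom; apply: ge0_le_integral => //.
- by move=> x _; rewrite lee_fin expVn2_ge0.
- by apply/measurable_EFinP; exact: measurable_expVn2.
- by apply/measurable_EFinP; apply: measurable_funM => //;
  exact: measurable_expVn2.
- by move=> x _; rewrite lee_fin; have := expVn2_ge0 x; lra.
Qed.
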